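(* Let $g_0(n)$ denote the maximum integer $g$ such that there exists a graph $G$ on $n$ vertices with $\mathrm{girth}(G)\geq g$ and $\pi(G)=n$. There exist $n_0$ and $c>0$ such that, for every $n\geq n_0$, $$g_0(n)\geq c\sqrt{\lg n}\,,$$ where $\lg$ denotes the base-2 logarithm.
   Context: Pebbling: a pebbling configuration on a graph $G$ is a distribution of pebbles to the vertices of $G$. A pebbling step removes two pebbles from a vertex $v$ that has at least two pebbles and places one pebble on a neighbor of $v$. Given a root vertex $r$, a configuration is $r$-solvable if some sequence of pebbling steps places a pebble on $r$; it is solvable if it is $r$-solvable for every vertex $r$. The pebbling number $\pi(G)$ is the least integer $\pi$ such that every configuration of $\pi$ pebbles on $G$ is solvable. The girth of a graph is the length of its shortest cycle. *)

(* Defs.v *)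
From Stdlib Require Import Relation_Operators.
From mathcomp Require Import all_boot all_order all_algebra.
From mathcomp Require Import boolp reals exp.

Set Implicit Arguments.
Unset Strict Implicit.
Unset Printing Implicit Defensive.

Import Order.TTheory GRing.Theory Num.Theory.

(* The least natural number satisfying P; None when there is none. *)
Definition least (P : nat -> Prop) : option nat :=
  match pselect (exists k, `[< P k >]) with
  | left exP => Some (ex_minn exP)
  | right _ => None
  end.

Definition is_max (P : nat -> Prop) (m : nat) : Prop :=
  P m /\ forall k, P k -> k <= m.

Record sgraph (T : finType) := SGraph {
  adj :> rel T;
  adj_sym : symmetric adj;
  adj_irrefl : irreflexive adj
}.

Section Graphs.
Variables (T : finType) (G : sgraph T).

(* [ucycle] alone would also accept the empty sequence and a single edge
   traversed back and forth, hence the bound on the size. *)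
Definition is_cycle (c : seq T) : Prop := ucycle G c /\ 2 < size c.

(* None stands for the infinite girth of an acyclic graph. *)
Definition girth : option nat :=
  least (fun k => exists c : seq T, is_cycle c /\ size c = k).

Definition girth_geq (g : nat) : Prop :=
  if girth is Some k then g <= k else True.

Definition config := {ffun T -> nat}.

Definition npebbles (f : config) : nat := \sum_(v : T) f v.

Definition pebbling_step (f f' : config) : Prop :=
  exists u v : T, [/\ G u v, 2 <= f u &
    f' = [ffun x => if x == u then f x - 2
                    else if x == v then (f x).+1 else f x]].

(* The sequence of steps may be empty: a configuration with a pebble on r is
   r-solvable. *)
Definition rsolvable (r : T) (f : config) : Prop :=
  exists f' : config, clos_refl_trans config pebbling_step f f' /\ 0 < f' r.

Definition solvable (f : config) : Prop := forall r : T, rsolvable r f.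

(* None occurs exactly when G is disconnected. *)
Definition pebbling_number : option nat :=
  least (fun p => forall f : config, npebbles f = p -> solvable f).

End Graphs.

(* m is the value of g_0(n).  No maximum exists for n <= 2, where some
   acyclic graph has pebbling number n. *)
Definition is_g0 (n m : nat) : Prop :=
  is_max (fun g => exists (T : finType) (G : sgraph T),
            [/\ #|T| = n, girth_geq G g & pebbling_number G = Some n]) m.

Definition lg (R : realType) (x : R) : R := (ln x / ln 2)%R.

(* Main.v *)
Require Import Defs.
From Stdlib Require Import Relation_Operators.
From mathcomp Require Import all_boot all_order all_algebra zify.
From mathcomp Require Import boolp reals exp.

(* Fix g, put k = 2^(4g), and let n >= 2^(20 g^2).  Split the n vertices into
   k paths ("rails", the residue classes modulo k) and greedily join every
   vertex to every rail, never creating a cycle shorter than g: the degrees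
   stay bounded by a polynomial in k, so balls of radius g are too small to
   block a rail.  Adding edges as long as some pair is at distance more than g
   makes the diameter at most g.  In this graph a set with fewer than k
   neighbours is, together with them, everything.

   Such a graph has pebbling number n.  Otherwise take an unsolvable
   configuration of n pebbles and let q = 2^g; no vertex can collect q pebbles.
   Around a vertex b with at least two pebbles, either q disjoint paths of
   pebbled vertices bring q pebbles to b, or, by Menger's theorem, fewer than q
   vertices separate b from the other such vertices and cut out a connected
   pebbled piece containing b.  Collecting disjoint pieces greedily, all of
   their neighbours are either empty or among the few separating vertices, and
   no vertex is adjacent to q pieces; since every piece has at least k > q^3
   neighbours, counting adjacencies gives a contradiction.

   For the maximum g_0(n) to exist, a graph with pebbling number n >= 3 must
   contain a cycle. *)

Set Implicit Arguments.
Unset Strict Implicit.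
Unset Printing Implicit Defensive.

(** * Menger's theorem for sets of directed edges *)

Section Menger.
Variable T : finType.
Implicit Types (E : {set T * T}) (A B S I : {set T}) (s : seq T).

Definition erel E : rel T := fun x y => (x, y) \in E.

Definition path_between E A B s : bool :=
  if s is x :: p then [&& x \in A, path (erel E) x p & last x p \in B]
  else false.

Definition separates E A B S : Prop :=
  forall s, path_between E A B s -> exists2 z, z \in s & z \in S.

Definition linked E A B (m : nat) : Prop :=
  exists I (p : T -> seq T),
    [/\ #|I| = m,
        forall i, i \in I -> path_between E A B (p i) && uniq (p i)
      & forall i j z, i \in I -> j \in I -> z \in p i -> z \in p j -> i = j].

Lemma path_between_sub E E' A A' B B' s :
  E \subset E' -> A \subset A' -> B \subset B' ->
  path_between E A B s -> path_between E' A' B' s.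
Proof.
move=> sE sA sB; case: s => //= x p /and3P[xA pp lB].
rewrite (subsetP sA) // (subsetP sB) // andbT /=.
by apply: sub_path pp => u v; apply: (subsetP sE).
Qed.

Lemma path_between_cut E A B s1 z s2 t1 t2 A' B' :
  path_between E A B' (s1 ++ z :: s2) -> path_between E A' B (t1 ++ z :: t2) ->
  path_between E A B (s1 ++ z :: t2).
Proof.
have tail : path_between E A' B (t1 ++ z :: t2) ->
    path (erel E) z t2 && (last z t2 \in B).
  case: t1 => [|y t1] /=; first by case/and3P=> _ -> ->.
  by rewrite cat_path last_cat /= => /and3P[_ /and3P[_ _ ->] ->].
move=> H /tail/andP[pt lt]; move: H.
case: s1 => [|x s1] /=; first by case/and3P=> -> _ _; rewrite pt lt.
by rewrite !cat_path !last_cat /= => /and3P[-> /and3P[-> -> _] _]; rewrite pt lt.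
Qed.

(** Disjoint paths have distinct ends, so [#|B|] of them exhaust [B] and can be reindexed by their
    last vertex, ready for gluing. *)
Lemma linked_last E A B : linked E A B #|B| ->
  exists p : T -> seq T,
    (forall y, y \in B -> path_between E A [set y] (p y) && uniq (p y)) /\
    (forall i j z, i \in B -> j \in B -> z \in p i -> z \in p j -> i = j).
Proof.
move=> [I [p [cI pI dI]]].
pose l i := last i (p i).
have pl i : i \in I -> [/\ l i \in B, path_between E A [set l i] (p i) & l i \in p i].
  move=> /pI; rewrite /l; case: (p i) => //= x s /andP[/and3P[-> -> ->] _].
  by rewrite set11 mem_last.
have linj : {in I &, injective l}.
  move=> i j iI jI e; case: (pl i iI) => _ _ mi; case: (pl j jI) => _ _ mj.
  by apply: (dI i j (l i)) => //; rewrite e.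
have lI : l @: I = B.
  apply/eqP; rewrite eqEcard (card_in_imset linj) cI leqnn andbT.
  by apply/subsetP=> _ /imsetP[i iI ->]; case: (pl i iI).
pose inv y := odflt y [pick i in I | l i == y].
have invP y : y \in B -> inv y \in I /\ l (inv y) = y.
  rewrite -lI => /imsetP[i iI ->]; rewrite /inv; case: pickP => [j /andP[jI /eqP]//|].
  by move=> /(_ i); rewrite iI eqxx.
exists (p \o inv); split=> [y /invP[yI e]|i j z /invP[iI ei] /invP[jI ej] zi zj] /=.
  by case: (pl _ yI); rewrite e => _ -> _; case/andP: (pI _ yI).
by rewrite -ei -ej (dI _ _ z iI jI zi zj).
Qed.

Lemma linked_head E A B : linked E A B #|A| ->
  exists p : T -> seq T,
    (forall y, y \in A -> path_between E [set y] B (p y) && uniq (p y)) /\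
    (forall i j z, i \in A -> j \in A -> z \in p i -> z \in p j -> i = j).
Proof.
move=> [I [p [cI pI dI]]].
pose l i := head i (p i).
have pl i : i \in I -> [/\ l i \in A, path_between E [set l i] B (p i) & l i \in p i].
  move=> /pI; rewrite /l; case: (p i) => //= x s /andP[/and3P[-> -> ->] _].
  by rewrite set11 mem_head.
have linj : {in I &, injective l}.
  move=> i j iI jI e; case: (pl i iI) => _ _ mi; case: (pl j jI) => _ _ mj.
  by apply: (dI i j (l i)) => //; rewrite e.
have lI : l @: I = A.
  apply/eqP; rewrite eqEcard (card_in_imset linj) cI leqnn andbT.
  by apply/subsetP=> _ /imsetP[i iI ->]; case: (pl i iI).
pose inv y := odflt y [pick i in I | l i == y].
have invP y : y \in A -> inv y \in I /\ l (inv y) = y.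
  rewrite -lI => /imsetP[i iI ->]; rewrite /inv; case: pickP => [j /andP[jI /eqP]//|].
  by move=> /(_ i); rewrite iI eqxx.
exists (p \o inv); split=> [y /invP[yI e]|i j z /invP[iI ei] /invP[jI ej] zi zj] /=.
  by case: (pl _ yI); rewrite e => _ -> _; case/andP: (pI _ yI).
by rewrite -ei -ej (dI _ _ z iI jI zi zj).
Qed.

(* A path up to its first visit to [P] uses no edge leaving [P]. *)
Lemma path_first E x0 y0 A B (P : {set T}) s : x0 \in P ->
  path_between E A B s -> has (mem P) s ->
  exists2 t, path_between (E :\ (x0, y0)) A P t & {subset t <= s}.
Proof.
move=> x0P; case: s => [//|x p] /=; move=> /and3P[xA pp _].
elim: p A x xA pp => [|y p IH] A x xA /= pp; last (move: pp => /andP[exy pp]; rewrite /erel in exy).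
  by rewrite orbF => xP; exists [:: x] => //=; rewrite xA xP.
case: (boolP (x \in P)) => [xP _|xP /= h].
  exists [:: x] => /=; first by rewrite xA xP.
  by move=> z; rewrite !inE => ->.
have [[//|z t] /= /and3P[]] := IH [set y] y (set11 y) pp h.
rewrite inE => /eqP-> pt lt sub; exists [:: x, y & t].
  rewrite /= xA pt lt /erel !inE exy !andbT.
  by apply: contraNneq xP => -[-> _].
move=> w; rewrite inE => /predU1P[->|/sub wy]; first exact: mem_head.
by rewrite inE wy orbT.
Qed.

(** After its last visit to [P] a path enters no vertex of [P], so it avoids every edge with head
    [y0]. *)
Lemma path_last E x0 y0 A B (P : {set T}) s : y0 \in P ->
  path_between E A B s -> has (mem P) s ->
  exists2 t, path_between (E :\ (x0, y0)) P B t & {subset t <= s}.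
Proof.
move=> y0P; case: s => [//|x p] /= /and3P[_ pp lB].
elim: p x pp lB => [|y p IH] x /= pp lB; last (move: pp => /andP[exy pp]; rewrite /erel in exy).
  by rewrite orbF => xP; exists [:: x] => //=; rewrite xP.
case: (boolP (has (mem P) (y :: p))) => [h _|h].
  have [t pt sub] := IH y pp lB h.
  by exists t => // w /sub wy; rewrite inE wy orbT.
rewrite /= in h; rewrite (negbTE h) orbF => xP.
exists [:: x, y & p] => //=; rewrite xP lB /erel !inE exy !andbT /=.
rewrite negb_or in h; case/andP: h => yP hp.
apply/andP; split; first by apply: contraNneq yP => -[_ ->].
elim: p y yP hp pp {IH exy lB} => //= z p IH y yP.
rewrite negb_or => /andP[zP hp] /andP[eyz pp]; rewrite /erel in eyz.
rewrite /erel !inE eyz andbT IH // andbT.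
by apply: contraNneq zP => -[_ ->].
Qed.

(* Goring's proof: an edge [(x, y)] whose deletion creates a separator [S]
   with fewer than [m] vertices makes [x |: S] and [y |: S] separators of size
   [m]; linkages from [A] to the first and from the second to [B] are glued
   along [S] and [(x, y)]. *)
Theorem menger E A B (m : nat) :
  (forall S, separates E A B S -> m <= #|S|) -> linked E A B m.
Proof.
have [n] := ubnP #|E|; elim: n E A B m => // n IH E A B m; rewrite ltnS => cE hS.
(* Without edges every path is a single vertex, so [A :&: B] separates. *)
case: (set_0Vmem E) => [E0|[[x y] exy]].
  have : m <= #|A :&: B|.
    apply: hS => -[//|z [|w p]] /=.
      by move=> /andP[zA zB]; exists z; rewrite !inE ?eqxx // zA zB.
    by rewrite /erel E0 !inE /= andbF.
  case/card_geqP=> s [us ss sub].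
  exists [set z in s], (fun z => [:: z]); split.
  - by rewrite cardsE -ss; apply/card_uniqP.
  - by move=> i; rewrite inE => /sub; rewrite inE /= => ->.
  - by move=> i j z _ _; rewrite !inE => /eqP-> /eqP.
set E' := E :\ (x, y).
have mono u p : path (erel E') u p -> path (erel E) u p.
  by apply: sub_path => v w; rewrite /erel inE => /andP[].
have cE' : #|E'| < n by rewrite /E' (cardsD1 (x, y) E) exy add1n in cE *.
case: (pselect (forall S, separates E' A B S -> m <= #|S|)) => [h|].
  have [I [p [cI pI dI]]] := IH E' A B m cE' h.
  exists I, p; split=> // i /pI/andP[pi ->]; rewrite andbT.
  by apply: path_between_sub pi; rewrite ?subxx // subsetDl.
move=> /existsNP[S /not_implyP[sepS /negP]]; rewrite -ltnNge => ltS.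
(* A path missing [x] or [y] survives in [E'], where [S] meets it. *)
have sepE s : path_between E A B s -> ~~ has (mem S) s -> x \in s /\ y \in s.
  move=> ps hs; suff : ~~ ((x \notin s) || (y \notin s)).
    by rewrite negb_or !negbK => /andP.
  apply/negP=> nxy; have : path_between E' A B s.
    case: s ps {hs} nxy => //= z p /and3P[-> pp ->] nxy; rewrite andbT /=.
    have -> : path (erel E') z p = path (erel E) z p; last by [].
    elim: p z pp nxy => //= w p IHp z /andP[ezw pp] nxy.
    rewrite IHp //; first congr (_ && _).
      rewrite /erel !inE; case: eqP => //= -[zx wy]; move: nxy.
      by rewrite zx wy !inE !eqxx /= orbT.
    by case/orP: nxy; rewrite in_cons negb_or => /andP[_ ->] //; rewrite orbT.
  by move=> /sepS[z zs zS]; case/hasP: hs; exists z.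
have sepP v : (forall s, path_between E A B s -> ~~ has (mem S) s -> v \in s) ->
    separates E A B (v |: S).
  move=> hv s ps; case: (boolP (has (mem S) s)) => [/hasP[z zs zS]|/(hv _ ps)].
    by exists z => //; rewrite inE (zS : z \in S) orbT.
  by move=> vs; exists v => //; rewrite setU11.
have sepx : separates E A B (x |: S) by apply: sepP => s ps /(sepE s ps)[].
have sepy : separates E A B (y |: S) by apply: sepP => s ps /(sepE s ps)[].
have card_sep v : separates E A B (v |: S) -> v \notin S /\ #|v |: S| = m.
  move=> /hS; rewrite cardsU1; case: (v \notin S) => /=.
    by move=> h; split=> //; apply/eqP; rewrite eqn_leq h andbT add1n.
  by rewrite add0n leqNgt ltS.
have [xS cx] := card_sep x sepx; have [yS cy] := card_sep y sepy.
have has_sep R s : separates E A B R -> path_between E A B s -> has (mem R) s.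
  by move=> sR /sR[z zs zR]; apply/hasP; exists z.
have [p1 [p1P p1d]] : exists p : T -> seq T,
    (forall v, v \in x |: S -> path_between E' A [set v] (p v) && uniq (p v)) /\
    (forall i j z, i \in x |: S -> j \in x |: S -> z \in p i -> z \in p j -> i = j).
  (* A separator [R] of [A] from [x |: S] in [E'] also separates [A] from [B] in [E]: cut each path
     at its first visit to [x |: S]. *)
  apply: linked_last; rewrite cx; apply: (IH _ _ _ _ cE') => R sR.
  apply: hS => s ps.
  have [t /sR[z zt zR] sub] := path_first y (setU11 x S) ps (has_sep _ _ sepx ps).
  by exists z => //; apply: sub.
have [p2 [p2P p2d]] : exists p : T -> seq T,
    (forall v, v \in y |: S -> path_between E' [set v] B (p v) && uniq (p v)) /\
    (forall i j z, i \in y |: S -> j \in y |: S -> z \in p i -> z \in p j -> i = j).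
  apply: linked_head; rewrite cy; apply: (IH _ _ _ _ cE') => R sR.
  apply: hS => s ps.
  have [t /sR[z zt zR] sub] := path_last x (setU11 y S) ps (has_sep _ _ sepy ps).
  by exists z => //; apply: sub.
have p1last v : v \in x |: S -> v \in p1 v.
  move=> /p1P/andP[+ _]; case: (p1 v) => //= a p /and3P[_ _]; rewrite inE => /eqP <-.
  exact: mem_last.
have p2head v : v \in y |: S -> exists t, p2 v = v :: t.
  move=> /p2P/andP[+ _]; case: (p2 v) => //= a p /and3P[+ _ _]; rewrite inE => /eqP <-.
  by exists p.
(* Splicing the two paths at [z] gives a path from [A] to [B] in [E'], which [S] meets in some [w].
   Since [w] is the end of its own linkage path, it can only be [z]. *)
have meet i j z : i \in x |: S -> j \in y |: S -> z \in p1 i -> z \in p2 j ->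
    [/\ z \in S, i = z & j = z].
  move=> iP jQ z1 z2.
  have /andP[b1 u1] := p1P i iP; have /andP[b2 u2] := p2P j jQ.
  have zS : z \in S.
    case/splitPr def1: _ / z1 b1 u1 => [s1 s2] b1 u1.
    case/splitPr def2: _ / z2 b2 u2 => [t1 t2] b2 u2.
    have [w] := sepS _ (path_between_cut b1 b2).
    rewrite mem_cat => /orP[ws wS|ws wS].
      have wi : i = w.
        apply: (p1d i w w) => //; rewrite ?inE ?wS ?orbT //.
          by rewrite def1 mem_cat ws.
        by apply: p1last; rewrite inE wS orbT.
      move: u1; rewrite cat_uniq => /and3P[_ /hasP[]].
      exists w => //; move: b1; case: (s1) => [|a r] /=.
        by case/and3P=> _ _; rewrite inE wi => /eqP <-; rewrite mem_last.
      by rewrite last_cat /= => /and3P[_ _]; rewrite inE wi => /eqP <-; rewrite mem_last.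
    have wj : j = w.
      apply: (p2d j w w) => //; rewrite ?inE ?wS ?orbT //.
        by rewrite def2 mem_cat ws orbT.
      by have [|t ->] := p2head w; rewrite ?inE ?wS ?orbT // eqxx.
    move: b2 u2; case: (t1) => [|a r] /=.
      by case/and3P; rewrite inE wj => /eqP-> _ _.
    case/and3P; rewrite inE wj => /eqP-> _ _.
    by rewrite mem_cat ws orbT.
  split=> //; first by apply: (p1d i z z) => //; rewrite ?inE ?zS ?orbT //;
    apply: p1last; rewrite inE zS orbT.
  apply: (p2d j z z) => //; rewrite ?inE ?zS ?orbT //.
  by have [|t ->] := p2head z; rewrite ?inE ?zS ?orbT // eqxx.
(* The path ending in [x] continues over the edge [(x, y)]; every other one continues from its own
   end, which [behead] keeps from being repeated. *)
pose sg i := if i == x then y else i.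
have sgQ i : i \in x |: S -> sg i \in y |: S.
  by rewrite /sg !inE; case: eqP => [|_ /= ->]; rewrite ?eqxx ?orbT.
pose p i := p1 i ++ (if i == x then p2 y else behead (p2 i)).
have pmem i z : z \in p i -> z \in p1 i \/ z \in p2 (sg i).
  rewrite /p /sg mem_cat => /orP[|]; first by left.
  by case: eqP => _; right=> //; apply: mem_behead.
exists (x |: S), p; split=> //.
- move=> i iP; have /andP[b1 u1] := p1P i iP.
  have /andP[b2 u2] := p2P (sg i) (sgQ i iP).
  have [t def2] := p2head _ (sgQ i iP).
  rewrite /p cat_uniq u1 /=; have mt z := @meet i (sg i) z iP (sgQ i iP); move: b2 u2 def2 mt.
  rewrite /sg; case: eqP => [ix|_] b2 u2 def2 mt.
    rewrite u2 andbT; apply/andP; split; last first.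
      apply/hasPn=> z z2; apply/negP=> z1.
      by have [zS _ yz] := mt z z1 z2; rewrite yz zS in yS.
    move: b1 b2; rewrite def2; case: (p1 i) => //= a r /and3P[-> pr].
    rewrite inE ix cat_path last_cat /= => /eqP-> /and3P[_ pt ->].
    by rewrite (mono _ _ pr) (mono _ _ pt) [erel E x y]exy.
  rewrite def2 /= in u2 b2 mt *; case/andP: u2 => it ut; rewrite ut andbT.
  apply/andP; split; last first.
    apply/hasPn=> z z2; apply/negP=> z1.
    have [|_ iz _] := mt z z1; first by rewrite inE z2 orbT.
    by rewrite iz z2 in it.
  move: b1 b2; case: (p1 i) => //= a r /and3P[-> pr].
  rewrite inE cat_path last_cat /= => /eqP-> /and3P[_ pt ->].
  by rewrite (mono _ _ pr) (mono _ _ pt).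
- have cross i j z : i \in x |: S -> j \in x |: S -> z \in p1 i -> z \in p2 (sg j) -> i = j.
    move=> iP jP z1 z2; have [zS -> e] := meet i (sg j) z iP (sgQ j jP) z1 z2.
    by move: e; rewrite /sg; case: eqP => // _ yz; rewrite yz zS in yS.
  move=> i j z iP jP /pmem[zi|zi] /pmem[zj|zj].
  + exact: (p1d i j z).
  + exact: (cross i j z).
  + by apply/esym; apply: (cross j i z).
  + have := p2d _ _ z (sgQ i iP) (sgQ j jP) zi zj; rewrite /sg.
    case: (i =P x) (j =P x) => [->|_] [->|_] // e.
      by move: jP; rewrite -e !inE (negbTE yS) orbF => /eqP->.
    by move: iP; rewrite e !inE (negbTE yS) orbF => /eqP->.
Qed.

End Menger.

(** * Superposing and transporting pebbles *)

Section Pebbling.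
Variables (T : finType) (G : sgraph T).
Implicit Types (f g : config T) (U A B S X D : {set T}).

Local Notation reaches := (clos_refl_trans (config T) (pebbling_step G)).

Definition addc f g : config T := [ffun x => f x + g x].
Definition restrc f U : config T := [ffun x => if x \in U then f x else 0].

Definition delivers f w m := exists f', reaches f f' /\ m <= f' w.

Lemma addcC f g : addc f g = addc g f.
Proof. by apply/ffunP=> x; rewrite !ffunE addnC. Qed.

Lemma reaches_add f f' g : reaches f f' -> reaches (addc f g) (addc f' g).
Proof.
elim=> [{}f {}f' [u [v [uv fu ->]]]|{}f|f1 f2 f3 _ h12 _ h23].
- apply: rt_step; exists u, v; split=> //; first by rewrite ffunE; lia.
  apply/ffunP=> x; rewrite !ffunE; case: eqP => [->|_]; first by lia.
  by case: eqP.
- exact: rt_refl.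
- exact: rt_trans h12 h23.
Qed.

Lemma delivers_add f g w m n :
  delivers f w m -> delivers g w n -> delivers (addc f g) w (m + n).
Proof.
move=> [f' [ff' mf]] [g' [gg' ng]]; exists (addc f' g'); split.
  apply: rt_trans (reaches_add g ff') _.
  by rewrite (addcC f' g) (addcC f' g'); apply: reaches_add.
by rewrite ffunE leq_add.
Qed.

Lemma delivers_le f g w m :
  (forall x, f x <= g x) -> delivers f w m -> delivers g w m.
Proof.
move=> fg [f' [ff' mf]].
have -> : g = addc f [ffun x => g x - f x].
  by apply/ffunP=> x; rewrite !ffunE subnKC.
eexists; split; first exact: reaches_add ff'.
by rewrite ffunE (leq_trans mf) ?leq_addr.
Qed.

(** Configurations with disjoint supports can be played independently, and the pebbles they bring to
    [w] add up. *)
Lemma delivers_disjoint f w (I : {set T}) (U : T -> {set T}) :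
  (forall i j z, i \in I -> j \in I -> z \in U i -> z \in U j -> i = j) ->
  (forall i, i \in I -> delivers (restrc f (U i)) w 1) -> delivers f w #|I|.
Proof.
move=> dU hU; suff H s : uniq s -> {subset s <= I} ->
    delivers (restrc f [set z | has (fun i => z \in U i) s]) w (size s).
  have sI : {subset enum I <= I} by move=> i; rewrite mem_enum.
  rewrite cardE; apply: delivers_le (H _ (enum_uniq I) sI) => x.
  by rewrite ffunE; case: ifP.
elim: s => [|i s IH] /=.
  by move=> _ _; eexists; split; [exact: rt_refl | ].
move=> /andP[inots us] sub.
have sI j : j \in s -> j \in I by move=> js; rewrite sub // inE js orbT.
have iI : i \in I by rewrite sub ?mem_head.
have := delivers_add (hU i iI) (IH us sI); rewrite add1n.
apply: delivers_le => x; rewrite !ffunE !inE.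
case: (boolP (x \in U i)) => [xi|_] //=.
case: hasP => [[j js xj]|_]; last by rewrite addn0.
by rewrite (dU i j x iI (sI j js) xi xj) js in inots.
Qed.

(** The pebble pushed onto the next vertex joins the one already there, which makes two again. A
    trivial path needs only one pebble. *)
Lemma delivers_path p x g : uniq (x :: p) -> path G x p ->
  (if p is [::] then 1 else 2) <= g x ->
  (forall z, z \in p -> z != last x p -> 1 <= g z) -> delivers g (last x p) 1.
Proof.
elim: p x g => [|y p IH] x g.
  by move=> _ _ gx _; exists g; split=> //; exact: rt_refl.
move=> /andP[xn up] /andP[xy py] gx hg.
pose g' : config T := [ffun z => if z == x then g z - 2
                    else if z == y then (g z).+1 else g z].
have st : reaches g g' by apply: rt_step; exists x, y.
have nx z : z \in y :: p -> (z == x) = false.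
  by move=> zp; apply: contraNF xn => /eqP<-.
have gg' z : z \in y :: p -> g z <= g' z.
  by move=> zp; rewrite ffunE nx //; case: ifP.
have [|z zp zl|h [hg' h1]] := IH y g' up py.
- have -> : g' y = (g y).+1 by rewrite ffunE nx ?mem_head // eqxx.
  case: p {IH gg' nx xn} up py hg => //= z p /andP[yn _] _ hg.
  rewrite ltnS hg ?mem_head //; apply: contraNneq yn => /= ->.
  exact: mem_last.
- by rewrite (leq_trans (hg z _ zl)) ?gg' // inE zp orbT.
- by exists h; split=> //; apply: rt_trans st hg'.
Qed.

Lemma delivers_edge f u v m : G u v -> delivers f u (2 * m) -> delivers f v m.
Proof.
move=> uv [f1 [ff1 h1]].
have nvu : (v == u) = false.
  by apply/eqP=> vu; rewrite vu (adj_irrefl G) in uv.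
have [f2 [f12 h2]] : exists f2, reaches f1 f2 /\ f1 v + m <= f2 v.
  elim: m f1 h1 {ff1} => [|m IH] f1 h1.
    by exists f1; rewrite addn0; split=> //; exact: rt_refl.
  pose f2 : config T := [ffun z => if z == u then f1 z - 2
                    else if z == v then (f1 z).+1 else f1 z].
  have st : reaches f1 f2 by apply: rt_step; exists u, v; split=> //; lia.
  have [|f3 [f23 h3]] := IH f2; first by rewrite ffunE eqxx; lia.
  exists f3; split; first exact: rt_trans st f23.
  by move: h3; rewrite ffunE nvu eqxx; lia.
exists f2; split; first exact: rt_trans ff1 f12.
by lia.
Qed.

Lemma delivers_far f w p : path G w p -> delivers f w (2 ^ size p) ->
  delivers f (last w p) 1.
Proof.
elim: p w => [|x p IH] w //= /andP[wx px].
by rewrite expnS => /(delivers_edge wx); apply: IH.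
Qed.

Definition nbhd A : {set T} := [set y in ~: A | [exists a in A, G a y]].

(** * Greedy collection of disjoint pebbled pieces *)

Section Pieces.
Variables (q : nat) (f : config T).

Let B := [set v | 2 <= f v].
Let Z := [set v | f v == 0].

(** [X] collects separators. Connectivity is expressed by simple paths from [b], the routes along
    which a pebble is pushed to a neighbour of [A]. *)
Definition piece X b A : Prop :=
  [/\ A :&: B = [set b],
      forall a, a \in A -> 1 <= f a,
      forall a, a \in A ->
        exists p, [/\ path G b p, last b p = a, uniq (b :: p) & {subset b :: p <= A}]
    & nbhd A \subset Z :|: X].

Lemma piece_mem X b A : piece X b A -> b \in A /\ 2 <= f b.
Proof.
by case=> /setP/(_ b); rewrite !inE eqxx => /andP[].
Qed.

Lemma piece_delivers X b A y : piece X b A -> y \in nbhd A ->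
  delivers (restrc f A) y 1.
Proof.
move=> pc; have [bA fb] := piece_mem pc; case: pc => _ fA cA _.
rewrite !inE => /andP[yA /exists_inP[a aA ay]].
have [p [pp lp up sub]] := cA a aA.
rewrite -(last_rcons b p y); apply: delivers_path.
- rewrite -rcons_cons rcons_uniq up andbT; apply: contra yA; exact: sub.
- by rewrite rcons_path pp lp.
- by rewrite ffunE bA; case: (rcons p y) => // ; apply: ltnW.
move=> z; rewrite mem_rcons last_rcons inE => /orP[/eqP->|zp]; first by rewrite eqxx.
by move=> _; rewrite ffunE sub ?fA ?sub // inE zp orbT.
Qed.

Hypothesis few : forall w, ~ delivers f w q.

(** Menger's theorem is applied between the other vertices of [B] and the neighbours of [b]. A
    linkage of size [q] would bring [q] pebbles to [b]; otherwise [A] is the component of [b] once a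
    small separator is removed. *)
Lemma new_piece X b : b \in B -> b \notin X ->
  exists S A, [/\ #|S| < q, piece (X :|: S) b A & [disjoint A & X]].
Proof.
rewrite inE => fb bX.
pose W := [set v | (0 < f v) && (v \notin X)].
(* Leaving out [b] makes the disjoint paths stop at distinct neighbours of [b], from which each
   sends one pebble to [b]. *)
pose E := [set uv : T * T | [&& G uv.1 uv.2, uv.1 \in W :\ b & uv.2 \in W :\ b]].
pose B0 := B :&: (W :\ b).
pose A0 := [set v in W :\ b | G v b].
case: (pselect (forall S, separates E B0 A0 S -> q <= #|S|)) => [/menger|].
  move=> [I [p [cI pI dI]]]; case: (few (w := b)); rewrite -cI.
  apply: (delivers_disjoint (U := fun i => [set z in p i])) => [i j z iI jI|i iI].
    by rewrite 2!inE; apply: dI.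
  have /andP[] := pI i iI; case: (p i) => //= x s /and3P[xB ps lA] us.
  case/setIP: xB; rewrite !inE => fx /andP[xb _].
  move: lA; rewrite inE => /andP[lW lb].
  have sW z : z \in s -> z \in W :\ b.
    elim: s x ps {us lW lb fx xb} => //= y s IH x /andP[exy py].
    move: exy; rewrite /erel inE => /and3P[_ _ yW].
    by rewrite in_cons => /predU1P[->//|]; apply: IH py.
  have -> : b = last x (rcons s b) by rewrite last_rcons.
  apply: delivers_path.
  - rewrite -rcons_cons rcons_uniq [uniq _]us andbT inE negb_or.
    rewrite eq_sym xb /=; apply/negP=> /sW.
    by rewrite !inE eqxx.
  - rewrite rcons_path lb andbT; apply: sub_path ps => u v.
    by rewrite /erel inE => /and3P[].
  - by rewrite ffunE !inE eqxx; case: (rcons s b) => // ; apply: ltnW.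
  move=> z; rewrite mem_rcons last_rcons inE => /orP[/eqP->|zs]; first by rewrite eqxx.
  move=> _; rewrite ffunE !inE zs orbT; have := sW z zs.
  by rewrite !inE => /and3P[].
move=> /existsNP[S /not_implyP[sepS /negP]]; rewrite -ltnNge => ltS.
(* [b] is put back explicitly, since [S] might contain it. *)
pose W' := b |: (W :\: S).
pose e := [rel u v | [&& u \in W', v \in W' & G u v]].
have esym : connect_sym e.
  by apply: sym_connect_sym => u v /=; rewrite andbCA (adj_sym G).
pose A := [set v | connect e b v].
have pathW u p : path e u p -> {subset p <= W'}.
  elim: p u => //= y p IH u /andP[/and3P[_ yW _] py] z.
  by rewrite inE => /orP[/eqP->|/(IH y py)].
have AW a : a \in A -> a \in W'.
  rewrite inE => /connectP[p pp ->]; have := mem_last b p.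
  by rewrite inE => /orP[/eqP->|/(pathW _ _ pp)] //; rewrite !inE eqxx.
have bA : b \in A by rewrite inE connect0.
have AfX a : a \in A -> 0 < f a /\ a \notin X.
  move/AW; rewrite !inE => /orP[/eqP->|/and3P[_ -> ->]] //.
  by split=> //; apply: leq_trans fb.
exists S, A; split=> //; last first.
  by apply/pred0P=> a /=; apply/negP=> /andP[/AfX[_ /negP]].
split.
(* Another vertex of [B] in [A] would be joined to a neighbour of [b] by a path avoiding [S]. *)
- apply/setP=> v; rewrite in_setI in_set1; case: eqP => [->|/eqP vb].
    by rewrite bA inE fb.
  apply/negP=> /andP[vA vB]; have vW' := AW v vA.
  move: vA; rewrite inE esym => /connectP[p0 pp0].
  case/shortenP: pp0 => p pp up _ {p0}.
  case: (lastP p) pp up => [|{}p y] pp up lp; first by rewrite lp eqxx in vb.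
  rewrite last_rcons in lp; move: pp up; rewrite -{}lp {y}.
  rewrite rcons_path -rcons_cons rcons_uniq => /andP[pp /and3P[lW' _ lb]] /andP[bp up].
  have pS z : z \in v :: p -> (z \in W :\ b) && (z \notin S).
    move=> zp; have zb : z != b by apply: contraNneq bp => <-.
    have : z \in W' by move: zp; rewrite inE => /orP[/eqP->|/(pathW _ _ pp)].
    by rewrite !inE (negbTE zb) /= => /and3P[-> -> ->].
  have [] := sepS (v :: p).
    have vW : v \in W :\ b by have /andP[] := pS v (mem_head _ _).
    rewrite /= in_setI vB vW inE lb /=.
    have /andP[-> _] := pS _ (mem_last v p); rewrite /= andbT.
    apply: (sub_in_path (P := mem (v :: p))) pp; last exact/allP.
    move=> x y xp yp /and3P[_ _ xy]; rewrite /erel inE /= xy.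
    by have /andP[-> _] := pS x xp; have /andP[-> _] := pS y yp.
  by move=> z /pS/andP[_ /negP].
- by move=> a /AfX[].
- move=> a; rewrite inE => /connectP[p0 pp0]; case/shortenP: pp0 => p pp up _ ->.
  exists p; split=> //; first by apply: sub_path pp => u v /and3P[].
  by move=> z zp; rewrite inE; apply: (path_connect pp).
(* A pebbled neighbour of [A] outside [X] and [S] would itself belong to the component of [b]. *)
apply/subsetP=> y; rewrite !inE => /andP[yA /exists_inP[a aA ay]].
case: eqP => //= /eqP fy; case: (boolP (y \in X)) => //= yX.
apply: contraR yA => yS; have aW := AW a aA; rewrite inE in aA.
apply: connect_trans aA (connect1 _); rewrite /= aW ay !inE yS yX lt0n fy.
by rewrite orbT.
Qed.

(** The factor [q.-1] is there because each piece contributes a separator with fewer than [q]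
    vertices to [X]. *)
Definition pieces D X (A : T -> {set T}) : Prop :=
  [/\ D \subset B, #|X| <= q.-1 * #|D|, forall b, b \in D -> piece X b (A b)
    & forall b c z, b \in D -> c \in D -> z \in A b -> z \in A c -> b = c].

Lemma piece_mono X X' b A : X \subset X' -> piece X b A -> piece X' b A.
Proof. by move=> sX [h1 h2 h3 h4]; split=> //; apply: subset_trans h4 (setUS _ sX). Qed.

(* A connected set that contains a vertex outside [A c] and avoids
   [Z :|: X], hence the neighbourhood of [A c], cannot enter [A c]. *)
Lemma piece_disjoint X X' b A c C : b != c ->
  piece X' b A -> [disjoint A & X] -> piece X c C -> [disjoint A & C].
Proof.
move=> bc pb dAX pc; have [bA fb] := piece_mem pb.
case: pb pc => [_ fA cA _] [CB _ _ nC].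
have bC : b \notin C.
  apply: contra bc => bC; have /setP/(_ b) := CB.
  by rewrite !inE bC fb /= => <-.
apply/pred0P=> z /=; apply/negP=> /andP[zA zC].
have [p [pp lp _ sub]] := cA z zA; move: lp sub bC.
elim: p b pp {bc bA fb cA} => [|y p IH] b /=; first by move=> _ ->; rewrite zC.
move=> /andP[by_ py] lp sub bC; case: (boolP (y \in C)) => [yC|]; last first.
  by apply: IH => // w wp; apply: sub; rewrite in_cons wp orbT.
have bA : b \in A by rewrite sub ?mem_head.
have : b \in Z :|: X.
  apply: (subsetP nC); rewrite !inE bC; apply/exists_inP; exists y => //.
  by rewrite (adj_sym G).
rewrite !inE => /orP[/eqP f0|bX]; first by have := fA b bA; rewrite f0.
by have := pred0P dAX b; rewrite /= bA bX.
Qed.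

(** A vertex of [B] outside [D :|: X] yields a new piece and enlarges [D], which cannot grow beyond
    [#|T|]. *)
Lemma exists_pieces : exists D X (A : T -> {set T}), pieces D X A /\ B \subset D :|: X.
Proof.
suff /(_ #|T|.+1)[D [X [A [PD]]]] n : exists D X (A : T -> {set T}),
    pieces D X A /\ (B \subset D :|: X \/ n <= #|D|).
  case=> [h|]; first by exists D, X, A.
  by rewrite ltnNge max_card.
elim: n => [|n [D [X [A [PD]]]]].
  exists set0, set0, (fun=> set0); split; last by right.
  by split; rewrite ?sub0set ?cards0 // => b; rewrite inE.
move=> h; case: (boolP (B \subset D :|: X)) => [sB|]; first by exists D, X, A; split=> //; left.
move=> nB; case: h => [sB|nD]; first by rewrite sB in nB.
case/subsetPn: nB => b bB; rewrite inE negb_or => /andP[bD bX].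
have [S [C [cS pC dC]]] := new_piece bB bX.
case: PD => DB cX pD dD.
exists (b |: D), (X :|: S), (fun c => if c == b then C else A c); split; last first.
  by right; rewrite cardsU1 bD.
have nb c : c \in D -> (c == b) = false by move=> cD; apply: contraNF bD => /eqP<-.
have disj c z : c \in D -> z \in C -> z \in A c -> False.
  move=> cD zC zA; have bc : b != c by rewrite eq_sym nb.
  have /pred0P/(_ z) := piece_disjoint bc pC dC (pD c cD).
  by rewrite /= zC zA.
split.
- by apply/subsetP=> c; rewrite in_setU1 => /predU1P[->//|]; apply: (subsetP DB).
- rewrite cardsU1 bD /= add1n mulnS.
  by apply: leq_trans (leq_card_setU _ _) _; lia.
- move=> c; rewrite in_setU1; case: eqP => [->|_ /= cD] //.
  by apply: piece_mono (pD c cD); apply: subsetUl.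
- move=> c c' z; rewrite !in_setU1.
  case: (c =P b) (c' =P b) => [->|_] [->|_] //=.
  + by move=> _ c'D zC zA; case: (disj c' z).
  + by move=> cD _ zA zC; case: (disj c z).
  + exact: dD.
Qed.

End Pieces.

(** Adjacencies between pieces and vertices number at least [k] per piece and at most [q.-1] per
    vertex of [Z :|: X]. As [#|Z| + #|X|] is at most [2 * q ^ 2 * #|D|], this contradicts the lower
    bound on [k]. *)
Theorem rsolvable_of_expansion (d k : nat) :
  (forall u v, exists p, [/\ path G u p, last u p = v & size p <= d]) ->
  (forall A, A != set0 -> k <= #|nbhd A| \/ A :|: nbhd A = setT) ->
  2 * (2 ^ d) ^ 3 <= k ->
  forall f, npebbles f = #|T| -> solvable G f.
Proof.
move=> diamG expG q_k f nf r; change (delivers f r 1).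
apply: contrapT => nr; set q := 2 ^ d in q_k.
(* From any vertex, [r] is at most [d] edges away and each edge halves the supply, so [2 ^ d]
   pebbles suffice. *)
have few w : ~ delivers f w q.
  move=> fw; have [p [pp lp sp]] := diamG w r; apply: nr; rewrite -lp.
  apply: delivers_far => //; case: fw => f' [ff' qf']; exists f'; split=> //.
  by apply: leq_trans qf'; rewrite leq_exp2l.
have [D [X [A [PD sB]]]] := exists_pieces few.
case: PD sB; set B := [set v | 2 <= f v] => DB cX pD dD sB.
pose Z := [set v | f v == 0].
have fq v : f v < q.
  by rewrite ltnNge; apply/negP=> h; apply: (few v); exists f; split=> //; exact: rt_refl.
have rZ : r \in Z.
  rewrite inE; apply/negP=> /negP; rewrite -lt0n => fr; apply: nr.
  by exists f; split=> //; exact: rt_refl.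
(* The average is one pebble per vertex, so the empty vertices are balanced by the surplus on [B],
   which is less than [q] at each vertex. *)
have cZ : #|Z| <= q * #|B|.
  have: \sum_v (f v + (v \in Z)) <= \sum_v (1 + (v \in B) * q).
    by apply: leq_sum => v _; rewrite !inE; have := fq v; case: (f v) => [|[|m]] /=; lia.
  rewrite !big_split /= -/(npebbles f) nf sum1_card -big_distrl /=.
  by rewrite -!big_mkcond /= !sum1_card mulnC leq_add2l.
have cB : #|B| <= #|D| + #|X|.
  by apply: leq_trans (subset_leq_card sB) (leq_card_setU _ _).
have Z1 : 0 < #|Z| by apply/card_gt0P; exists r.
(* The empty vertex [r] is not in a piece, and as a neighbour of one it would receive a pebble; so
   the second alternative of [expG] fails. *)
have exp b : b \in D -> k <= #|nbhd (A b)|.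
  move=> bD; have pb := pD b bD; have [bA _] := piece_mem pb.
  case: (expG (A b)) => //; first by apply/set0Pn; exists b.
  move/setP/(_ r); rewrite in_setT in_setU => /orP[rA|rN].
    case: pb => _ /(_ r rA); rewrite inE in rZ; by rewrite (eqP rZ).
  case: nr; apply: delivers_le (piece_delivers pb rN) => x.
  by rewrite ffunE; case: ifP.
have inc x : #|[set b in D | x \in nbhd (A b)]| <= q.-1.
  rewrite -ltnS prednK ?expn_gt0 // ltnNge; apply/negP=> h; apply: (few x).
  have [g [fg gx]] : delivers f x #|[set b in D | x \in nbhd (A b)]|.
    apply: (delivers_disjoint (U := A)) => [i j z|b]; rewrite in_set.
      by move=> /andP[iD _]; rewrite in_set => /andP[jD _]; apply: dD.
    by move=> /andP[bD xN]; apply: piece_delivers (pD b bD) xN.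
  by exists g; split=> //; apply: leq_trans h gx.
have cnt : k * #|D| <= (#|Z| + #|X|) * q.-1.
  have h1 : k * #|D| <= \sum_(b in D) #|nbhd (A b)|.
    by rewrite mulnC -sum_nat_const; apply: leq_sum.
  have h2 : \sum_(b in D) #|nbhd (A b)| <= 
            \sum_(x in Z :|: X) #|[set b in D | x \in nbhd (A b)]|.
    have e b : b \in D ->
        #|nbhd (A b)| = \sum_(x in Z :|: X | x \in nbhd (A b)) 1.
      move=> bD; rewrite -sum1_card; apply: eq_bigl => x.
      case: (boolP (x \in nbhd (A b))) => [xN|]; last by rewrite andbF.
      by have [_ _ _ /subsetP->] := pD b bD.
    rewrite (eq_bigr _ e) (exchange_big_dep (mem (Z :|: X))) /=; last first.
      by move=> b x _ /andP[].
    apply: leq_sum => x xZX; rewrite -sum1_card; apply: eq_leq.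
    by apply: eq_bigl => b; rewrite in_set xZX.
  apply: leq_trans h1 (leq_trans h2 _).
  apply: leq_trans (_ : #|Z :|: X| * q.-1 <= _); last by rewrite leq_mul2r leq_card_setU orbT.
  by rewrite -sum_nat_const; apply: leq_sum.
have q0 : 0 < q by rewrite expn_gt0.
(* Without pieces [X] and [B] are empty, hence so is [Z], which contains [r]. *)
have D0 : 0 < #|D|.
  rewrite lt0n; apply/eqP=> D0; move: cX cB; rewrite D0 muln0 leqn0 => /eqP->.
  by rewrite leqn0 => /eqP B0; rewrite B0 muln0 leqNgt Z1 in cZ.
have qD : #|D| + #|X| <= q * #|D|.
  by rewrite -(prednK q0) mulSn leq_add2l.
have ZX : #|Z| + #|X| <= 2 * q ^ 2 * #|D|.
  have hX : #|X| <= q * (q * #|D|).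
    by apply: leq_trans (leq_pmull _ q0); apply: leq_trans qD; apply: leq_addl.
  have hZ : #|Z| <= q * (q * #|D|).
    by apply: leq_trans cZ _; rewrite leq_mul2l (leq_trans cB qD) orbT.
  by rewrite expnS expn1; lia.
have : k * #|D| < 2 * q ^ 3 * #|D|.
  apply: leq_ltn_trans cnt _; apply: leq_ltn_trans (leq_mul ZX (leqnn _)) _.
  have -> : 2 * q ^ 3 * #|D| = 2 * q ^ 2 * #|D| * q by rewrite (expnS q 2); nia.
  by rewrite ltn_pmul2l ?prednK // !muln_gt0 D0 !expn_gt0.
by rewrite ltn_pmul2r // ltnNge q_k.
Qed.

End Pebbling.

(** * Adding edges without creating short cycles *)

Section EdgeAddition.
Variable T : finType.
Implicit Types (E : rel T) (x y u v : T).

Definition no_short_cycle E (g : nat) : Prop :=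
  forall c, ucycle E c -> 2 < size c -> g <= size c.

Definition add_edge E x y : rel T := fun a b =>
  [|| E a b, (a == x) && (b == y) | (a == y) && (b == x)].
Arguments add_edge E x y a b /.

Definition degree E x := #|[set y | E x y]|.

Fixpoint ball E (d : nat) x : {set T} :=
  if d is d'.+1 then x |: \bigcup_(z in [set z | E x z]) ball E d' z
  else [set x].

Lemma add_edge_sym E x y : symmetric E -> symmetric (add_edge E x y).
Proof. by move=> sE a b /=; rewrite sE (andbC (b == x)) (andbC (b == y)) (orbC (_ && _)). Qed.

Lemma add_edge_irr E x y : irreflexive E -> x != y -> irreflexive (add_edge E x y).
Proof.
move=> iE xy a /=; rewrite iE /=; apply/negbTE; rewrite negb_or; apply/andP.
by split; apply: contra xy => /andP[/eqP<- /eqP<-].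
Qed.

Lemma prev_head u p : u \notin p -> prev (u :: p) u = last u p.
Proof.
rewrite /=; move: {4 5}u => w; elim: p w => [|y p IH] w /=; first by rewrite eqxx.
by rewrite in_cons negb_or => /andP[/negbTE-> /IH].
Qed.

(** Removing the new edge from a cycle that uses it leaves an [E]-path between [x] and [y], which is
    long by hypothesis. *)
Lemma add_edge_no_short_cycle E x y g : symmetric E ->
  (forall p, path E x p -> last x p = y -> g <= (size p).+1) ->
  no_short_cycle E g -> no_short_cycle (add_edge E x y) g.
Proof.
move=> sE far gE c /andP[cyc uc] sc.
case: (boolP (cycle E c)) => [cE|ncE]; first by apply: gE => //; apply/andP.
(* The step into [u] is the new edge; rotating the cycle to [u] makes it the closing step. *)
have [u uin nu] : exists2 u, u \in c & ~~ E (prev c u) u.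
  apply/exists2P; apply: contraNP ncE => /forallNP h.
  by apply: cycle_from_prev uc _ => u uin; apply: contraPT (h u) => nE; apply.
have [i p rc] := rot_to uin.
have up : uniq (u :: p) by rewrite -rc rot_uniq.
have szp : size c = (size p).+1 by rewrite -(size_rot i) rc.
have {}nu : ~~ E (last u p) u.
  by rewrite -prev_head -?rc ?prev_rot //; case/andP: up.
have := cyc; rewrite -(rot_cycle i) rc /= rcons_path => /andP[pp].
rewrite /= (negbTE nu) /= => ends.
(* The new edge contains [u], which does not recur in [p], and its other end is the last vertex,
   which differs from the first vertex of [p] because the cycle has length above 2. *)
have upE : path E u p.
  case: p {rc nu} up szp pp ends => // b p /andP[un /andP[bp up]] szp /andP[ub pp] ends.
  have lb : b != last b p.
    by case: (p) bp szp sc => [|z q] bp -> //= _; apply: contraNneq bp => ->; apply: mem_last.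
  have xy : (x = last b p /\ y = u) \/ (x = u /\ y = last b p).
    by case/orP: ends => /andP[/eqP<- /eqP<-]; [left | right].
  rewrite /=; apply/andP; split.
    case/or3P: ub => // /andP[/eqP e1 /eqP e2]; case: xy => -[e3 e4].
    - by rewrite e2 e4 mem_head in un.
    - by rewrite -e4 e2 eqxx in lb.
    - by rewrite -e3 e2 eqxx in lb.
    - by rewrite e2 e3 mem_head in un.
  apply: (sub_in_path (P := predC1 u)) pp => [a a'|].
    rewrite 2!inE => au a'u /or3P[//||] /andP[/eqP e1 /eqP e2];
      by case: xy au a'u => -[e3 e4]; rewrite e1 e2 e3 e4 eqxx.
  by apply/allP=> z zp /=; apply: contraNneq un => <-.
rewrite szp; case/orP: ends => /andP[/eqP l1 /eqP l2]; last first.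
  by apply: far; rewrite -?l2.
(* Here the new edge is traversed from [x] to [y], so the path is reversed to start at [x]. *)
have := far (rev (belast u p)); rewrite size_rev size_belast; apply.
  by rewrite -l1 rev_path; apply: sub_path upE => a b; rewrite sE.
case: p {szp rc up pp nu} l1 upE => [|z q] //= ; first by move=> <-.
by rewrite rev_cons last_rcons.
Qed.

Lemma add_edge_degree E u v x :
  degree (add_edge E u v) x <= degree E x + (x == u) + (x == v).
Proof.
rewrite /degree; set N := [set y | E x y].
have sub : [set y | add_edge E u v x y] \subset
    N :|: ((if x == u then [set v] else set0) :|: (if x == v then [set u] else set0)).
  apply/subsetP=> z; rewrite !inE => /or3P[->//|/andP[/eqP-> /eqP->]|/andP[/eqP-> /eqP->]].
    by rewrite eqxx !inE eqxx orbT.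
  by rewrite eqxx !inE eqxx !orbT.
apply: leq_trans (subset_leq_card sub) _; apply: leq_trans (leq_card_setU _ _) _.
rewrite -addnA leq_add2l; apply: leq_trans (leq_card_setU _ _) _.
by apply: leq_add; case: ifP; rewrite ?cards1 ?cards0.
Qed.

Lemma mem_ball E d x p : path E x p -> size p <= d -> last x p \in ball E d x.
Proof.
elim: d x p => [|d IH] x [|y p] //=; rewrite ?inE ?eqxx // ltnS => /andP[xy pp] sp.
by apply/orP; right; apply/bigcupP; exists y; rewrite ?inE ?IH.
Qed.

Lemma card_bigcup_le (A : {set T}) (F : T -> {set T}) m :
  (forall z, z \in A -> #|F z| <= m) -> #|\bigcup_(z in A) F z| <= #|A| * m.
Proof.
move=> h; rewrite -sum_nat_const.
apply: (big_rec2 (fun (X : {set T}) s => #|X| <= s)) => [|z s X zA hX].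
  by rewrite cards0.
by apply: leq_trans (leq_card_setU _ _) _; apply: leq_add; rewrite ?h.
Qed.

Lemma card_ball E d x (m : nat) :
  (forall z, degree E z <= m) -> #|ball E d x| <= m.+1 ^ d.
Proof.
move=> h; elim: d x => [|d IH] x /=; first by rewrite cards1.
rewrite expnS mulSn; apply: leq_trans (leq_card_setU _ _) _.
apply: leq_add; first by rewrite cards1 expn_gt0.
apply: leq_trans (card_bigcup_le (m := m.+1 ^ d) _) _ => [z _|]; first exact: IH.
by rewrite leq_mul2r h orbT.
Qed.

(** Joining two vertices at distance more than [g] closes only cycles longer than [g]. The number of
    non-adjacent pairs drops each time, so the process stops. *)
Lemma extend_to_small_diameter E g : 0 < g ->
  symmetric E -> irreflexive E -> no_short_cycle E g ->
  exists E', [/\ symmetric E', irreflexive E', no_short_cycle E' g, subrel E E' &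
    forall u v, exists p, [/\ path E' u p, last u p = v & size p <= g]].
Proof.
move=> g0; have [n] := ubnP #|[set uv : T * T | ~~ E uv.1 uv.2]|.
elim: n E => // n IH E; rewrite ltnS => cE sE iE gE.
case: (pselect (forall u v, exists p, [/\ path E u p, last u p = v & size p <= g])).
  by move=> h; exists E; split.
move=> /existsNP[u /existsNP[v /forallNP h]].
have uv : u != v by apply/eqP=> uv; apply: (h [::]).
have nE : ~~ E u v by apply/negP=> Euv; apply: (h [:: v]); rewrite /= Euv.
have [||||E' [sE' iE' gE' EE' dE']] := IH (add_edge E u v).
- apply: leq_trans cE; apply: proper_card; apply/properP; split.
    by apply/subsetP=> -[a b]; rewrite !inE; apply: contra => /= ->.
  by exists (u, v); rewrite !inE //= !eqxx orbT.
- exact: add_edge_sym.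
- exact: add_edge_irr.
- apply: add_edge_no_short_cycle => // p pp lp; rewrite leqNgt; apply/negP=> sp.
  by apply: (h p); split=> //; apply: ltnW; apply: ltn_trans sp.
by exists E'; split=> // a b ab; apply: EE'; rewrite /= ab.
Qed.

End EdgeAddition.

Arguments add_edge [T] E x y a b /.

(** * Rails, the greedy construction and expansion *)

Section Rails.
Variables (n k : nat).
Hypothesis k_gt0 : 0 < k.

Definition rails : rel 'I_n := fun a b => (a + k == b) || (b + k == a).
Arguments rails a b /.

Lemma rails_sym : symmetric rails.
Proof. by move=> a b /=; rewrite orbC. Qed.

Lemma rails_irr : irreflexive rails.
Proof. by move=> a /=; lia. Qed.

(* The two neighbours of the largest vertex of a cycle would both lie [k]
   below it. *)
Lemma rails_acyclic c : ucycle rails c -> ~ 2 < size c.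
Proof.
move=> /andP[cyc uc] sc.
have [x0 x0c] : exists x, x \in c by case: c sc {cyc uc} => // x c _; exists x; rewrite mem_head.
case: (arg_maxnP (fun x : 'I_n => x : nat) x0c) => m mc mmax.
have [i p rc] := rot_to mc.
have : size (m :: p) = size c by rewrite -rc size_rot.
have : uniq (m :: p) by rewrite -rc rot_uniq.
have : cycle rails (m :: p) by rewrite -rc rot_cycle.
have le z : z \in p -> z <= m.
  by move=> zp; have /mmax : z \in c by rewrite -(mem_rot i) rc inE zp orbT.
case: p le {rc} => [|a [|b p]] le /=; try by move=> _ _ e; rewrite -e in sc.
rewrite rcons_path => /and3P[ma _ /andP[_ lm]] /and4P[_ an _ _] _.
have lp : last b p \in b :: p by apply: mem_last.
have ha := le a (mem_head _ _).
have hl : last b p <= m by apply: le; rewrite inE lp orbT.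
suff e : a = last b p by rewrite e lp in an.
apply: val_inj; move: ma lm ha hl => /=.
by move: (nat_of_ord a) (nat_of_ord (last b p)) (nat_of_ord m) => *; lia.
Qed.

Lemma rails_degree x : degree rails x <= 2.
Proof.
pose N := enum [set y | rails x y].
have sub : {subset map (@nat_of_ord n) N <= [:: x + k; x - k]}.
  by move=> w /mapP[z]; rewrite mem_enum !inE /= => h ->; lia.
have := uniq_leq_size _ sub; rewrite size_map -cardE; apply.
by rewrite map_inj_uniq ?enum_uniq //; apply: val_inj.
Qed.

Definition rail (j : 'I_k) : {set 'I_n} := [set u : 'I_n | u %% k == j].

Lemma card_rail j : n %/ k <= #|rail j|.
Proof.
have lt (i : 'I_(n %/ k)) : j + i * k < n.
  have := leq_trunc_div n k; have := ltn_ord j; have := ltn_ord i; nia.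
pose f i := Ordinal (lt i).
have fi : injective f.
  by move=> a b /(congr1 val) /= /addnI/eqP; rewrite eqn_pmul2r // => /eqP/val_inj.
rewrite -[X in X <= _]card_ord -(card_imset _ fi); apply: subset_leq_card.
by apply/subsetP=> _ /imsetP[i _ ->]; rewrite inE /= addnC modnMDl modn_small.
Qed.

(* [D] bounds the degree before the edges a vertex receives for its own
   demands; the arithmetical hypothesis says that saturated vertices and a
   ball of radius [g] never cover a rail. *)
Lemma exists_rail_neighbours g D : 2 <= D ->
  (forall s, D * s <= 2 * n + 2 * (n * k) -> s + (D + k).+1 ^ g < n %/ k) ->
  exists E : rel 'I_n, [/\ symmetric E, irreflexive E, no_short_cycle E g,
    subrel rails E & forall v j, exists2 u, E v u & u \in rail j].
Proof.
move=> D2 hD.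
(* [M] records the demands met so far; the demand [(v, j)] asks for an edge from [v] to rail [j]. *)
have grow t : t <= n * k -> exists (E : rel 'I_n) (M : {set 'I_n * 'I_k}),
  [/\ #|M| = t, [/\ symmetric E, irreflexive E, no_short_cycle E g & subrel rails E],
    forall v, degree E v <= D + #|[set j | (v, j) \in M]|,
    \sum_v degree E v <= 2 * n + 2 * t &
    forall v j, (v, j) \in M -> exists2 u, E v u & u \in rail j].
  elim: t => [_|t IH lt].
    exists rails, set0; split; rewrite ?cards0 //.
    - split=> //; [exact: rails_sym|exact: rails_irr|].
      by move=> c cc sc; case: (rails_acyclic cc sc).
    - by move=> v; rewrite (leq_trans (rails_degree v)) // (leq_trans D2) ?leq_addr.
    - apply: (@leq_trans (\sum_(v : 'I_n) 2)).
        by apply: leq_sum => v _; apply: rails_degree.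
      by rewrite sum_nat_const card_ord; lia.
    - by move=> v j; rewrite inE.
  have [E [M [cM [sE iE gE RE] degE sumE demE]]] := IH (ltnW lt).
  have [[v j] vjM] : exists vj, vj \notin M.
    apply/existsP; rewrite -negb_forall; apply/negP=> /forallP h.
    move: lt; rewrite -cM ltnNge; case/negP.
    have -> : M = setT by apply/setP=> z; rewrite inE h.
    by rewrite cardsT card_prod !card_ord.
  pose sat := [set u | D <= degree E u].
  (* Each demand adds 2 to the degree sum, and each saturated vertex accounts for at least [D] of
     it. *)
  have csat : D * #|sat| <= 2 * n + 2 * (n * k).
    apply: leq_trans (_ : \sum_v degree E v <= _); last by apply: leq_trans sumE _; lia.
    rewrite mulnC -sum_nat_const [X in _ <= X](bigID (mem sat)) /=.
    by apply: leq_trans (leq_addr _ _); apply: leq_sum => u; rewrite inE.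
  have degDk u : degree E u <= D + k.
    by apply: leq_trans (degE u) _; rewrite leq_add2l -[X in _ <= X]card_ord max_card.
  have [u uj] : exists2 u, u \in rail j & u \notin sat :|: ball E g v.
    apply/exists2P; apply: contrapT => /forallNP h.
    have sub : rail j \subset sat :|: ball E g v.
      apply/subsetP=> u uj; apply: contrapT => nu; apply: (h u); split=> //.
      by apply/negP.
    have := leq_trans (card_rail j) (leq_trans (subset_leq_card sub) (leq_card_setU _ _)).
    rewrite leqNgt; case/negP; apply: leq_ltn_trans (hD _ csat).
    by rewrite leq_add2l card_ball.
  rewrite in_setU negb_or in_set -ltnNge => /andP[du ub].
  have uv : v != u by apply: contraNneq ub => <-; apply: (mem_ball (p := [::])).
  exists (add_edge E v u), ((v, j) |: M); split.
  - by rewrite cardsU1 vjM cM.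
  - split; [exact: add_edge_sym | exact: add_edge_irr | |].
      apply: add_edge_no_short_cycle => // p pp lp; rewrite leqNgt; apply/negP=> sp.
      by case/negP: ub; rewrite -lp mem_ball // ltnW // (ltn_trans _ sp).
    by move=> a b /RE ab; apply/or3P; apply: Or31.
  (* The new edge at [v] is charged to the demand [(v, j)]; the other end [u] was unsaturated, so
     its degree is still at most [D]. *)
  - move=> w; apply: leq_trans (add_edge_degree _ _ _ _) _.
    have hw : (w == v) + #|[set i | (w, i) \in M]| <= #|[set i | (w, i) \in (v, j) |: M]|.
      case: (eqVneq w v) => [->|wv].
        have -> : [set i | (v, i) \in (v, j) |: M] = j |: [set i | (v, i) \in M].
          by apply/setP=> i; rewrite !inE xpair_eqE eqxx.
        by rewrite cardsU1 inE vjM.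
      by apply: subset_leq_card; apply/subsetP=> i; rewrite !inE => ->; rewrite orbT.
    have dw := degE w; case: (eqVneq w u) => [wu|_] /=; last first.
      by rewrite addn0; apply: leq_trans (leq_add dw (leqnn _)) _; rewrite -addnA leq_add2l addnC.
    have -> : (w == v) = false by rewrite wu eq_sym; apply: negbTE.
    by rewrite addn0 wu addn1; apply: leq_trans du _; apply: leq_addr.
  - apply: (@leq_trans (\sum_w (degree E w + (w == v) + (w == u)))).
      by apply: leq_sum => w _; apply: add_edge_degree.
    rewrite !big_split /= -!big_mkcond /=.
    have one (w : 'I_n) : \sum_(i | i == w) 1 = 1 by rewrite big_pred1_eq.
    rewrite !one; apply: leq_trans (leq_add (leq_add sumE (leqnn 1)) (leqnn 1)) _.
    by lia.
  - move=> w i; rewrite in_setU1 => /predU1P[[-> ->]|/demE[z wz zi]].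
      by exists u; rewrite //= !eqxx orbT.
    by exists z; rewrite //= wz.
have [E [M [cM [sE iE gE RE] _ _ demE]]] := grow _ (leqnn (n * k)).
exists E; split=> // v j; apply: demE.
suff -> : M = setT by rewrite inE.
by apply/eqP; rewrite eqEcard subsetT cM cardsT card_prod !card_ord /=.
Qed.

(** Fewer than [k] neighbours miss some rail entirely. A vertex of [A] has a neighbour on that rail,
    which must lie in [A]; following the rail never leaves [A], so [A] contains it all, and every
    vertex is adjacent to it. *)
Lemma rails_expand (G : sgraph 'I_n) : subrel rails G ->
  (forall v j, exists2 u, G v u & u \in rail j) ->
  forall A : {set 'I_n}, A != set0 -> k <= #|nbhd G A| \/ A :|: nbhd G A = setT.
Proof.
move=> RG dem A /set0Pn[a aA].
case: (leqP k #|nbhd G A|) => [|cN]; [by left | right].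
pose res (u : 'I_n) : 'I_k := Ordinal (ltn_pmod u k_gt0).
have [j jN] : exists j, j \notin res @: nbhd G A.
  apply/existsP; rewrite -negb_forall; apply/negP=> /forallP h.
  have := leq_imset_card res (nbhd G A).
  rewrite (_ : res @: _ = setT) ?cardsT ?card_ord; first by rewrite leqNgt cN.
  by apply/setP=> z; rewrite inE h.
have stay x y : x \in A -> G x y -> y \in rail j -> y \in A.
  move=> xA xy yj; apply: contraR jN => yA; apply/imsetP; exists y.
    by rewrite !inE yA; apply/exists_inP; exists x.
  by apply: val_inj; move: yj; rewrite inE => /eqP.
have [u au uj] := dem a j; have uA := stay a u aA au uj.
have shift i (x y : 'I_n) : x \in rail j -> y = x + i * k :> nat -> (x \in A) = (y \in A).
  elim: i y => [|i IH] y xj yE; first by rewrite (_ : y = x) //;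
    apply: val_inj; rewrite /= yE mul0n addn0.
  have lt : x + i * k < n by have := ltn_ord y; rewrite yE; nia.
  rewrite (IH (Ordinal lt) xj) //=.
  have inj (z : 'I_n) e : z = x + e * k :> nat -> z \in rail j.
    by move=> ze; rewrite inE ze addnC modnMDl; move: xj; rewrite inE.
  have ly : rails (Ordinal lt) y by rewrite /= yE; apply/orP; left; lia.
  apply/idP/idP => h.
    by apply: stay h _ (inj y i.+1 yE); apply: RG.
  apply: stay h _ (inj (Ordinal lt) i erefl).
  by rewrite (adj_sym G); apply: RG.
have shift_le (x y : 'I_n) : x \in rail j -> y \in rail j -> x <= y -> (x \in A) = (y \in A).
  move=> xj yj xy; apply: (shift ((y - x) %/ k)) => //.
  rewrite divnK ?subnKC // -eqn_mod_dvd //.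
  by move: xj yj; rewrite !inE => /eqP-> /eqP->.
have railA w : w \in rail j -> w \in A.
  by move=> wj; case/orP: (leq_total u w) => h; [rewrite -(shift_le u w) | rewrite (shift_le w u)].
apply/setP=> w; rewrite in_setT in_setU; case: (boolP (w \in A)) => //= wA.
have [z wz zj] := dem w j; rewrite !inE wA; apply/exists_inP; exists z; first exact: railA.
by rewrite (adj_sym G).
Qed.

End Rails.

(** * Lower bound on the pebbling number, and cycles *)

Section PebblingNumber.
Variables (T : finType) (G : sgraph T).
Implicit Types f : config T.

Local Notation reaches := (clos_refl_trans (config T) (pebbling_step G)).

Lemma reaches_invariant (Q : config T -> Prop) f f' :
  (forall a b, Q a -> pebbling_step G a b -> Q b) -> reaches f f' -> Q f -> Q f'.
Proof.
move=> step; elim=> [a b ab Qa|//|a b c _ ab _ bc /ab/bc //].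
exact: step ab.
Qed.

(** With single pebbles on [p] distinct vertices no step is possible. *)
Lemma unsolvable_lt_card p : p < #|T| ->
  exists f, npebbles f = p /\ ~ solvable G f.
Proof.
move=> pT; have /card_geqP[s [us ss _]] := ltnW pT.
pose f : config T := [ffun x => (x \in s) : nat].
exists f; split.
  rewrite /npebbles -ss -(card_uniqP us) -sum1_card [RHS]big_mkcond /=.
  by apply: eq_bigr => x _; rewrite ffunE; case: (x \in s).
have [r rs] : exists r, r \notin s.
  apply/existsP; rewrite -negb_forall; apply: contraL pT => /forallP h.
  by rewrite -leqNgt -ss -(card_uniqP us); apply: subset_leq_card; apply/subsetP.
move=> /(_ r)[f' [ff' ]].
rewrite (reaches_invariant (Q := fun a => a = f) _ ff') //.
  by rewrite ffunE (negbTE rs).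
move=> a b -> [u [v [_ +]]]; rewrite ffunE; by case: (u \in s).
Qed.

Lemma pebbling_number_card :
  (forall f, npebbles f = #|T| -> solvable G f) -> pebbling_number G = Some #|T|.
Proof.
move=> h; rewrite /pebbling_number /least; case: pselect => [exP|[]]; last first.
  by exists #|T|; apply/asboolP.
congr Some; case: ex_minnP => m /asboolP mP mmin; apply/eqP.
rewrite eqn_leq mmin /=; last exact/asboolP.
by rewrite leqNgt; apply/negP=> /unsolvable_lt_card[f [/mP]].
Qed.

Lemma solvable_pebbling_number p f :
  pebbling_number G = Some p -> npebbles f = p -> solvable G f.
Proof.
rewrite /pebbling_number /least; case: pselect => // exP [<-].
by case: ex_minnP => m /asboolP mP _; apply: mP.
Qed.

Hypothesis class0 : forall f, npebbles f = #|T| -> solvable G f.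

(** All pebbles are stacked on [u]; steps never take them out of its component. *)
Lemma class0_connected u v : connect G u v.
Proof.
pose f : config T := [ffun x => (x == u) * #|T|].
have [|f' [ff' fv]] := class0 (f := f) _ v.
  rewrite /npebbles (bigD1 u) //= ffunE eqxx mul1n big1 ?addn0 // => x xu.
  by rewrite ffunE (negbTE xu).
have := reaches_invariant (Q := fun a => forall x, 0 < a x -> connect G u x) _ ff'.
apply=> // [a b Qa [y [z [yz ay ->]]] x|x].
  rewrite ffunE; case: eqP => [->|_]; first by move=> _; apply: Qa; lia.
  case: eqP => [-> _|_]; last exact: Qa.
  by apply: connect_trans (connect1 yz); apply: Qa; lia.
by rewrite ffunE; case: eqP => [->|].
Qed.

Lemma class0_path3 : 2 < #|T| -> exists x p, [/\ uniq (x :: p), path G x p & size p = 2].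
Proof.
move=> /card_geqP[s [+ + _]].
case: s => [|u [|v [|w []]]] // /and3P[un vw _] _.
move: un vw; rewrite !inE negb_or => /andP[uv uw] vw.
have adj_or y : u != y -> G u y \/ exists x p, [/\ uniq (x :: p), path G x p & size p = 2].
  move=> uy; have /connectP[p0 pp0] := class0_connected u y.
  case/shortenP: pp0 => p pp up _ {p0}.
  case: p pp up => [|a [|b p]] /=; first by move=> _ _ e; rewrite e eqxx in uy.
    by rewrite andbT => ua _ ->; left.
  move=> /and3P[ua ab _] /and3P[]; rewrite !inE !negb_or => /and3P[n1 n2 _] /andP[n3 _] _ _.
  by right; exists u, [:: a; b]; rewrite /= ua ab !inE !negb_or n1 n2 n3.
case: (adj_or v uv) => // Guv; case: (adj_or w uw) => // Guw.
exists v, [:: u; w]; rewrite /= Guw (adj_sym G) Guv !inE !negb_or vw uw eq_sym.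
by rewrite uv.
Qed.

(* In an acyclic graph the first vertex of a longest path
   [x0 :: x1 :: x2 :: p] is a leaf; three pebbles on it, none on [x1] and [x2]
   and one elsewhere cannot reach [x2]. *)
Lemma class0_cyclic : 2 < #|T| -> exists c, is_cycle G c.
Proof.
move=> T3; apply: contrapT => acyc.
pose P m := `[< exists x p, [/\ uniq (x :: p), path G x p & size p = m] >].
have exP : exists m, P m by exists 2; apply/asboolP; apply: class0_path3.
have bP m : P m -> m <= #|T|.
  move=> /asboolP[x [p [up _ <-]]]; apply: leq_trans (leqnSn _) _.
  by have /card_uniqP := up; move=> /= <-; apply: max_card.
case: (ex_maxnP exP bP) => m /asboolP[x0 [p [up pp sp]]] mmax.
have m2 : 2 <= m by apply: mmax; apply/asboolP; apply: class0_path3.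
case: p sp up pp => [|x1 [|x2 p]]; try by move=> e; rewrite -e in m2.
move=> sp up pp.
(* Another neighbour of [x0] would prolong the longest path if it lay off it, and close a cycle if
   it lay on it. *)
have leaf y : G x0 y -> y = x1.
  move=> xy; apply: contrapT => /eqP yx1.
  have yx0 : y != x0 by apply: contraTneq xy => ->; rewrite (adj_irrefl G).
  case: (boolP (y \in x2 :: p)) => [yp|yp]; last first.
    have : m.+1 <= m; last by rewrite ltnn.
    apply: mmax; apply/asboolP; exists y, [:: x0, x1, x2 & p].
    rewrite -sp; split=> //; last by rewrite /= (adj_sym G) xy.
    by rewrite cons_uniq up andbT !inE !negb_or yx0 yx1; move: yp; rewrite inE negb_or.
  case/splitPr: yp up pp => s1 s2 up pp.
  have uc : uniq [:: x0, x1 & rcons s1 y].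
    by move: up; rewrite -cat_rcons -!cat_cons cat_uniq => /and3P[].
  have pc : path G x0 (x1 :: rcons s1 y).
    by move: pp; rewrite -cat_rcons -cat_cons cat_path => /andP[].
  apply: acyc; exists [:: x0, x1 & rcons s1 y]; split; last by rewrite /= size_rcons.
  rewrite /ucycle uc andbT [cycle _ _]rcons_path pc /= last_rcons.
  by rewrite (adj_sym G).
have x01 : x0 != x1 by move: up => /= /andP[]; rewrite inE negb_or => /andP[].
have x02 : x0 != x2.
  by move: up => /= /andP[]; rewrite !inE !negb_or => /and3P[].
have x12 : x1 != x2.
  by move: up => /= /and3P[_]; rewrite !inE !negb_or => /andP[].
pose f : config T := [ffun x => if x == x0 then 3 else
   if (x == x1) || (x == x2) then 0 else 1].
pose f1 : config T := [ffun x => if x == x2 then 0 else 1].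
have [|f' [ff' ]] := class0 (f := f) _ x2.
  (* The two extra pebbles on [x0] make up for the missing ones on [x1] and [x2]. *)
  have : \sum_x (f x + (x == x1) + (x == x2)) = \sum_x (1 + (x == x0) * 2).
    apply: eq_bigr => x _; rewrite ffunE; case: (eqVneq x x0) => [->|_].
      by rewrite (negbTE x01) (negbTE x02).
    by case: (eqVneq x x1) => [->|_]; [rewrite (negbTE x12) | case: (x == x2)].
  rewrite !big_split /= -big_distrl /= -!big_mkcond /=.
  by rewrite !big_pred1_eq sum1_card -addnA; apply: (@addIn 2).
(* The only step from [f] goes from [x0] to [x1] and gives [f1], where no step is possible. *)
have [->|->] : f' = f \/ f' = f1.
- apply: (reaches_invariant (Q := fun a => a = f \/ a = f1) _ ff'); last by left.
  move=> a b [] -> [u [v [uv + ->]]]; rewrite ffunE; last by case: (u == x2).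
  case: eqP => [ux _|_]; last by case: (_ || _).
  have vx : v = x1 by apply: leaf; rewrite -ux.
  right; apply/ffunP=> x; rewrite !ffunE ux vx.
  case: (eqVneq x x0) => [->|_]; first by rewrite (negbTE x02).
  by case: (eqVneq x x1) => [->|_] /=; rewrite ?(negbTE x12).
- by rewrite ffunE eqxx orbT eq_sym (negbTE x02).
- by rewrite ffunE eqxx.
Qed.

Lemma class0_girth_le g : 2 < #|T| -> girth_geq G g -> g <= #|T|.
Proof.
move=> T3; have [c cc] := class0_cyclic T3.
rewrite /girth_geq /girth /least; case: pselect => [exP|[]]; last first.
  by exists (size c); apply/asboolP; exists c.
case: ex_minnP => m /asboolP[c' [[/andP[_ uc] _] <-]] _ gm.
by apply: leq_trans gm _; rewrite -(card_uniqP uc) max_card.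
Qed.

End PebblingNumber.

(** * Choice of parameters and the final estimate *)

Lemma girth_geq_of_no_short_cycle (T : finType) (G : sgraph T) g :
  no_short_cycle G g -> girth_geq G g.
Proof.
rewrite /girth_geq /girth /least => h; case: pselect => // exP.
by case: ex_minnP => m /asboolP[c [[cc sc] <-]] _; apply: h.
Qed.

(** After multiplication by [k], the saturated vertices take at most a quarter of [n], and the ball
    with one extra vertex at most another quarter. *)
Lemma greedy_arith g n s : 0 < g -> 2 ^ (20 * g ^ 2) <= n ->
  let k := 2 ^ (4 * g) in let D := 16 * k ^ 2 in
  D * s <= 2 * n + 2 * (n * k) -> s + (D + k).+1 ^ g < n %/ k.
Proof.
move=> g0 hn k D hs; have k0 : 0 < k by rewrite expn_gt0.
have hs' : 4 * (s * k) <= n.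
  rewrite -(leq_pmul2r (_ : 0 < 4 * k)) ?muln_gt0 //.
  by apply: leq_trans (leq_trans hs _); rewrite /D -?mulnn; move: (k) k0 => a; nia.
(* [16 * k ^ 2 + k + 1] is at most [32 * k ^ 2 = 2 ^ (8 * g + 5)], and [(8 * g + 5) * g] is at most
   [13 * g ^ 2]. *)
have hM : (D + k).+1 ^ g <= 2 ^ (13 * g ^ 2).
  apply: (@leq_trans ((2 ^ (8 * g + 5)) ^ g)).
    have k2 : 2 ^ (8 * g) = k ^ 2 by rewrite -expnM; congr expn; lia.
    rewrite leq_exp2r // expnD k2.
    rewrite /D (_ : 2 ^ 5 = 32) // -mulnn; move: (k) k0 => a; nia.
  by rewrite -expnM leq_exp2l //; nia.
have hM' : 4 * ((2 ^ (13 * g ^ 2)).+1 * k) <= n.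
  apply: leq_trans hn.
  (* In the exponent, 1 absorbs the successor, 2 the factor 4, and [4 * g] is the factor [k]. *)
  apply: (@leq_trans (2 ^ (13 * g ^ 2 + 1 + 2 + 4 * g))); last by rewrite leq_exp2l //; nia.
  rewrite (expnD 2 (_ + 2)) (expnD 2 (_ + 1)) (expnD 2 (13 * _)) -/k expn1.
  rewrite (_ : 2 ^ 2 = 4) //; have : 0 < 2 ^ (13 * g ^ 2) by rewrite expn_gt0.
  move: (2 ^ (13 * g ^ 2)) (k) => m a m0; rewrite mulnA leq_mul2r; apply/orP; right; lia.
rewrite leq_divRL //; move: hM hM' k0 hs'.
by move: ((D + k).+1 ^ g) (2 ^ (13 * g ^ 2)) (k) => a b c; nia.
Qed.

Theorem exists_class0_girth g n : 0 < g -> 2 ^ (20 * g ^ 2) <= n ->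
  exists G : sgraph 'I_n, girth_geq G g /\ pebbling_number G = Some n.
Proof.
move=> g0 hn; set k := 2 ^ (4 * g); have k0 : 0 < k by rewrite expn_gt0.
have [|s|E [sE iE gE RE dE]] := @exists_rail_neighbours n k k0 g (16 * k ^ 2).
- by rewrite -[2]muln1 leq_mul // expn_gt0 k0.
- exact: greedy_arith.
have [E' [sE' iE' gE' EE' diam]] := extend_to_small_diameter g0 sE iE gE.
pose G := SGraph sE' iE'.
exists G; split; first exact: girth_geq_of_no_short_cycle.
rewrite -[X in Some X](card_ord n); apply: pebbling_number_card.
apply: (@rsolvable_of_expansion _ G g k diam).
  apply: (rails_expand k0) => [a b ab|v j]; first by apply: EE'; apply: RE.
  by have [u vu uj] := dE v j; exists u => //; apply: EE'.
(* [2 * (2 ^ g) ^ 3 = 2 ^ (3 * g + 1)] is at most [k = 2 ^ (4 * g)] since [g] is positive. *)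
by rewrite -expnM -expnS leq_exp2l //; lia.
Qed.

(** Every competing graph contains a cycle, which bounds its girth by [n], so the maximum is
    attained. *)
Lemma is_g0_exists n g (T : finType) (G : sgraph T) : 2 < n ->
  #|T| = n -> girth_geq G g -> pebbling_number G = Some n ->
  exists2 m, is_g0 n m & g <= m.
Proof.
move=> n3 cT gG pG.
pose P g := exists (T : finType) (G : sgraph T),
            [/\ #|T| = n, girth_geq G g & pebbling_number G = Some n].
have Pg : P g by exists T, G.
have exP : exists h, `[< P h >] by exists g; apply/asboolP.
have bP h : `[< P h >] -> h <= n.
  move=> /asboolP[T' [G' [cT' gG' pG']]]; rewrite -cT'.
  apply: class0_girth_le gG'; rewrite ?cT' // => f.
  exact: solvable_pebbling_number.
case: (ex_maxnP exP bP) => m /asboolP Pm mmax.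
exists m; last by apply: mmax; apply/asboolP.
by split=> // h Ph; apply: mmax; apply/asboolP.
Qed.
Import Order.TTheory GRing.Theory Num.Theory.
Local Open Scope ring_scope.

Lemma sqrt_lg_le (R : realType) (n N g : nat) : (0 < n)%N -> (n <= 2 ^ N)%N ->
  (N <= (9 * g) ^ 2)%N -> 9^-1 * Num.sqrt (lg n%:R) <= g%:R :> R.
Proof.
move=> n0 nN Ng.
rewrite ler_pdivrMl ?ltr0n //.
have -> : 9 * g%:R = Num.sqrt (((9 * g) ^ 2)%N%:R) :> R.
  by rewrite natrX sqrtr_sqr natrM ger0_norm // mulr_ge0 // ler0n.
apply: ler_wsqrtr; apply: (@le_trans _ _ N%:R); last by rewrite ler_nat.
have l2 : 0 < ln 2 :> R by rewrite ln_gt0 // ltr1n.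
rewrite /lg ler_pdivrMr // mulr_natl -lnXn ?ltr0n //.
by rewrite ler_ln ?posrE ?exprn_gt0 ?ltr0n // -natrX ler_nat.
Qed.

Theorem theorem5 (R : realType) :
  exists (n0 : nat) (c : R), 0 < c /\
    forall n : nat, (n0 <= n)%N ->
      exists g : nat, is_g0 n g /\ c * Num.sqrt (lg n%:R) <= g%:R.
Proof.
(* This threshold makes 3 an admissible girth, so the largest admissible [g] is at least 3 and [n]
   exceeds 2. *)
exists (2 ^ (20 * 3 ^ 2))%N, 9^-1; split; first by rewrite invr_gt0 ltr0n.
move=> n hn.
pose P g := (2 ^ (20 * g ^ 2) <= n)%N.
have bP g : P g -> (g <= n)%N.
  apply: leq_trans; apply: leq_trans (ltnW (ltn_expl g (isT : 1 < 2)%N)) _.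
  by rewrite leq_exp2l //; nia.
have exP : exists g, P g by exists 3.
case: (ex_maxnP exP bP) => g Pg gmax.
have g3 : (3 <= g)%N by apply: gmax.
have [G [gG pG]] := exists_class0_girth (ltnW (ltnW g3)) Pg.
have n3 : (2 < n)%N by apply: leq_trans g3 (bP _ Pg).
have [m mg0 gm] := is_g0_exists n3 (card_ord n) gG pG.
exists m; split=> //; apply: le_trans (_ : _ <= g%:R) _; last by rewrite ler_nat.
(* Maximality of [g] gives [n < 2 ^ (20 * g.+1 ^ 2)]. The constant 9 comes from [20 * g.+1 ^ 2 <= 80
   * g ^ 2 <= (9 * g) ^ 2]. *)
apply: (@sqrt_lg_le _ _ (20 * g.+1 ^ 2)) => //; first by apply: ltnW (ltnW n3).
  by rewrite ltnW // ltnNge; apply/negP=> /gmax; rewrite ltnn.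
by nia.
Qed.
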